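(* Let $q\in\mathbb{C}$, $q\neq 0$, $q$ not a root of unity, let $n\ge 0$ be an integer, and let $b\in\mathbb{C}$, $b\neq 0$. Let $Q_n(\,\cdot\,;a,b\,|\,q)$ denote the Al-Salam--Chihara polynomial and $U_n^{(b)}(\,\cdot\,;q)$ the Al-Salam--Carlitz I polynomial. Then for every $x\in\mathbb{C}$ $$\lim_{a\to\infty} a^{-n}\, Q_n\big(\tfrac12 a x;\,a,\,ab\,|\,q\big)=U_n^{(b)}(x;q).$$
   Context: Notation: $(\beta;q)_k:=\prod_{j=0}^{k-1}(1-\beta q^j)$. For $a\ne0$ with $(ab;q)_n\ne0$, the Al-Salam--Chihara polynomial is defined, with $x=z+z^{-1}$, by $$Q_n\big(\tfrac12 x;a,b\,|\,q\big)=\frac{(ab;q)_n}{a^n}\sum_{k=0}^n\frac{(q^{-n};q)_k\,(az;q)_k\,(az^{-1};q)_k}{(ab;q)_k\,(q;q)_k}\,q^k .$$ It is a polynomial in $x$, since $(az;q)_k(az^{-1};q)_k=\prod_{j=0}^{k-1}(1-axq^j+a^2q^{2j})$. (In the limit, the parameters are $a$ and $ab$, and the expression is well defined for $|a|$ sufficiently large.) For $b\neq0$ the Al-Salam--Carlitz I polynomial is defined by $$U_n^{(b)}(x;q)=(-b)^n q^{n(n-1)/2}\sum_{k=0}^n\frac{(q^{-n};q)_k\,(x^{-1};q)_k}{(q;q)_k}\,(qb^{-1}x)^k ,$$ where $x^k(x^{-1};q)_k$ is read as the polynomial $\prod_{j=0}^{k-1}(x-q^j)$, so that the formula also makes sense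 at $x=0$. *)

(* Defs.v *)
From HB Require Import structures.
From mathcomp Require Import all_boot all_order all_algebra.
From mathcomp Require Import complex.
From mathcomp Require Import ring.
From mathcomp Require Import boolp classical_sets reals filter topology normedtype.

Set Implicit Arguments.
Unset Strict Implicit.
Unset Printing Implicit Defensive.

Import Order.TTheory GRing.Theory Num.Theory.
Import numFieldNormedType.Exports.

Local Open Scope classical_set_scope.
Local Open Scope ring_scope.

Definition qpoch (F : fieldType) (beta q : F) (k : nat) : F :=
  \prod_(j < k) (1 - beta * q ^+ j).

Definition al_salam_chihara_z (F : fieldType) (n : nat) (z a b q : F) : F :=
  qpoch (a * b) q n / a ^+ n *
  \sum_(k < n.+1)
    qpoch (q ^- n) q k * qpoch (a * z) q k * qpoch (a * z^-1) q k
    / (qpoch (a * b) q k * qpoch q q k) * q ^+ k.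

(* A solution z of (z + z^-1) / 2 = y. The other solution is z^-1, and the
   expression above is symmetric under z <-> z^-1. *)
Definition joukowski_inv (C : numClosedFieldType) (y : C) : C :=
  y + sqrtC (y ^+ 2 - 1).

(* Q_n(y; a, b | q). The choice of z is immaterial: see [al_salam_chiharaE]. *)
Definition al_salam_chihara (C : numClosedFieldType) (n : nat) (y a b q : C) : C :=
  al_salam_chihara_z n (joukowski_inv y) a b q.

(* The k-th factor stands for x ^ k * (x^-1; q)_k, a polynomial in x, so that
   x = 0 is allowed. *)
Definition al_salam_carlitz1 (F : fieldType) (n : nat) (b x q : F) : F :=
  (- b) ^+ n * q ^+ 'C(n, 2) *
  \sum_(k < n.+1)
    qpoch (q ^- n) q k / qpoch q q k * (q * b^-1) ^+ k
    * \prod_(j < k) (x - q ^+ j).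

(* Neighbourhoods of the point at infinity of the complex plane, |a| -> oo.
   The library's [+oo] taken at R[i] would only constrain a along the positive
   real axis. *)
Definition cinfty_nbhs (R : realType) : set_system R[i] :=
  [set P | exists M : R, forall a : R[i], M%:C%C < `|a| -> P a].
Arguments cinfty_nbhs R : clear implicits.

Lemma qpoch_pairE (F : fieldType) (a z q : F) (k : nat) : z != 0 ->
  qpoch (a * z) q k * qpoch (a * z^-1) q k =
  \prod_(j < k) (1 - a * (z + z^-1) * q ^+ j + a ^+ 2 * q ^+ (2 * j)).
Proof.
move=> z0; rewrite /qpoch -big_split /=; apply: eq_bigr => j _.
by rewrite mulnC exprM; field.
Qed.

Lemma joukowski_invK (C : numClosedFieldType) (y : C) :
  joukowski_inv y != 0 /\ joukowski_inv y + (joukowski_inv y)^-1 = 2 * y.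
Proof.
rewrite /joukowski_inv; set s := sqrtC _.
have s2 : s ^+ 2 = y ^+ 2 - 1 by rewrite sqrtCK.
have e : (y + s) * (y - s) = 1.
  by rewrite mulrC -subr_sqr s2; ring.
have z0 : y + s != 0.
  by apply/eqP => h; move: e; rewrite h mul0r => /eqP; rewrite eq_sym oner_eq0.
split => //; have -> : (y + s)^-1 = y - s.
  by apply: (mulfI z0); rewrite e mulfV.
by ring.
Qed.

Lemma al_salam_chiharaE (C : numClosedFieldType) (n : nat) (z a b q : C) :
  z != 0 ->
  al_salam_chihara n (2^-1 * (z + z^-1)) a b q = al_salam_chihara_z n z a b q.
Proof.
move=> z0; rewrite /al_salam_chihara /al_salam_chihara_z.
have [w0 wE] := joukowski_invK (2^-1 * (z + z^-1)).
congr (_ * _); apply: eq_bigr => k _.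
rewrite -[in LHS](mulrA (qpoch (q ^- n) q k)) -[in RHS](mulrA (qpoch (q ^- n) q k)).
by rewrite !qpoch_pairE // wE mulVKf // pnatr_eq0.
Qed.

Lemma cinfty_nbhs_filter (R : realType) : ProperFilter (cinfty_nbhs R).
Proof.
split.
  move=> [M /(_ (`|M| + 1)%:C%C)]; apply.
  rewrite normc_def /= expr0n /= addr0 sqrtr_sqr ltcR ger0_norm ?addr_ge0 //.
  by rewrite (le_lt_trans (ler_norm M)) // ltrDl.
split; first by exists 0.
  move=> P Q [M hM] [N hN]; exists (Num.max M N) => a ha; split.
    by apply: hM; apply: le_lt_trans ha; rewrite lecR le_max lexx.
  by apply: hN; apply: le_lt_trans ha; rewrite lecR le_max lexx orbT.
by move=> P Q PQ [M hM]; exists M => a /hM /PQ.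
Qed.

#[global] Existing Instance cinfty_nbhs_filter.

(* Main.v *)
Require Import Defs.
From HB Require Import structures.
From mathcomp Require Import all_boot all_order all_algebra.
From mathcomp Require Import complex.
From mathcomp Require Import ring.
From mathcomp Require Import boolp classical_sets reals filter topology normedtype.

Import Order.TTheory GRing.Theory Num.Theory.
Import numFieldNormedType.Exports.

Local Open Scope classical_set_scope.
Local Open Scope ring_scope.

(** With [u = a ^- 2], absorbing a factor [a ^- 2] into each factor of the
    q-shifted factorials containing [a] turns [a ^- n * Q_n] into a rational
    function of [u] which is regular at [u = 0]; its value there is [U_n]. *)

Definition rescaled_al_salam_chihara {F : fieldType} (n : nat) (b x q u : F) : F :=
  \prod_(j < n) (u - b * q ^+ j) *
  \sum_(k < n.+1)
    qpoch (q ^- n) q k / qpoch q q k * q ^+ k *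
    \prod_(j < k) ((u - x * q ^+ j + q ^+ (2 * j)) / (u - b * q ^+ j)).

Lemma prodr_constMl {R : comPzSemiRingType} (c : R) (k : nat) (f : 'I_k -> R) :
  \prod_(j < k) (c * f j) = c ^+ k * \prod_(j < k) f j.
Proof. by rewrite big_split /= prodr_const card_ord. Qed.

Lemma qpoch_sqr {F : fieldType} (a b q : F) (k : nat) : a != 0 ->
  qpoch (a * (a * b)) q k = a ^+ (2 * k) * \prod_(j < k) (a ^- 2 - b * q ^+ j).
Proof.
move=> a0; rewrite exprM -prodr_constMl.
by apply: eq_bigr => j _; field.
Qed.

(** Since [z + z^-1 = a * x], every factor involving [a] is [a ^+ 2] times an expression in
    [a ^- 2]. The powers [a ^+ (2 * k)] then cancel within the [k]-th term, and [a ^+ (2 * n)] from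
    the prefactor absorbs both copies of [a ^- n]. *)
Lemma al_salam_chihara_rescaledE {C : numClosedFieldType} (n : nat) (a b x q : C) :
  a != 0 ->
  a ^- n * al_salam_chihara n (2^-1 * (a * x)) a (a * b) q =
  rescaled_al_salam_chihara n b x q (a ^- 2).
Proof.
move=> a0; rewrite /al_salam_chihara /al_salam_chihara_z.
have [z0 zE] := joukowski_invK (2^-1 * (a * x)).
rewrite mulVKf ?pnatr_eq0 // in zE.
rewrite /rescaled_al_salam_chihara qpoch_sqr // mulrA; congr (_ * _).
  rewrite mul2n -addnn exprD; have an0 : a ^+ n != 0 by rewrite expf_neq0.
  by field.
apply: eq_bigr => k _; rewrite -(mulrA (qpoch (q ^- n) q k)) qpoch_pairE // zE.
have -> : \prod_(j < k) (1 - a * (a * x) * q ^+ j + a ^+ 2 * q ^+ (2 * j)) =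
    a ^+ (2 * k) * \prod_(j < k) (a ^- 2 - x * q ^+ j + q ^+ (2 * j)).
  rewrite exprM -prodr_constMl.
  by apply: eq_bigr => j _; field.
rewrite qpoch_sqr // big_split /= prodfV !invfM.
have ak0 : a ^+ (2 * k) != 0 by rewrite expf_neq0.
set A := \prod_(j < k) _; set B := (\prod_(j < k) (_ - b * _))^-1.
set D := (qpoch q q k)^-1.
by field.
Qed.

(** At [u = 0] the [j]-th quotient is [(q ^+ (2 * j) - x * q ^+ j) / (- b * q ^+ j) = b^-1 * (x - q
    ^+ j)]. *)
Lemma rescaled_al_salam_chihara0 {F : fieldType} (n : nat) (b x q : F) :
  q != 0 -> b != 0 ->
  rescaled_al_salam_chihara n b x q 0 = al_salam_carlitz1 n b x q.
Proof.
move=> q0 b0; rewrite /rescaled_al_salam_chihara /al_salam_carlitz1.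
congr (_ * _).
  transitivity (\prod_(j < n) (- b * q ^+ j)).
    by apply: eq_bigr => j _; rewrite sub0r mulNr.
  rewrite prodr_constMl; congr (_ * _).
  (* The exponents [0, ..., n - 1] of [q] add up to ['C(n, 2)]. *)
  by rewrite -bin2_sum big_mkord expr_sum.
apply: eq_bigr => k _; rewrite exprMn -!mulrA; do 3!congr (_ * _).
rewrite -prodr_constMl.
apply: eq_bigr => j _; rewrite mulnC exprM.
by field; rewrite b0 oppr_eq0 mulf_neq0 ?expf_neq0.
Qed.

(** Only the division could break continuity at [0], and the denominators tend to [- b * q ^+ j],
    which is nonzero. *)
Lemma cvg_rescaled_al_salam_chihara {K : numFieldType} {T : Type}
    (F : set_system T) {FF : Filter F} (u : T -> K) (n : nat) (b x q : K) :
  q != 0 -> b != 0 -> u t @[t --> F] --> (0 : K) ->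
  rescaled_al_salam_chihara n b x q (u t) @[t --> F]
    --> rescaled_al_salam_chihara n b x q 0.
Proof.
move=> q0 b0 u0.
(* Joint continuity of the iterated operation is a side condition of [cvg_big], for the sum and for
   the products. *)
have addc : continuous (fun p : K * K => p.1 + p.2) by exact: add_continuous.
have mulc : continuous (fun p : K * K => p.1 * p.2) by exact: mul_continuous.
have den j : u t - b * q ^+ j @[t --> F] --> (0 - b * q ^+ j : K).
  by apply: cvgB u0 _; exact: cvg_cst.
apply: cvgM; first by apply: cvg_big.
apply: cvg_big => // k _; apply: cvgM; first exact: cvg_cst.
apply: cvg_big => // j _; apply: cvgM.
  by apply: cvgD; [apply: cvgB u0 _|]; exact: cvg_cst.
by apply: cvgV => //; rewrite sub0r oppr_eq0 mulf_neq0 ?expf_neq0.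
Qed.

Lemma cvg_inv_cinfty {R : realType} :
  (a^-1 : R[i]^o) @[a --> cinfty_nbhs R] --> (0 : R[i]^o).
Proof.
(* The threshold must lie in [R] while [eps] lies in [R[i]]; being positive, [eps^-1] is real and
   equals its real part. *)
apply/cvgr0Pnorm_lt => eps eps0; exists (complex.Re eps^-1) => a.
have eps'0 : 0 < eps^-1 by rewrite invr_gt0.
rewrite RRe_real ?realE ?(ltW eps'0) // => ha.
by rewrite normfV -[ltRHS]invrK ltf_pV2 // posrE (lt_trans eps'0 ha).
Qed.

Theorem mainTheorem2 (R : realType) (q : R[i]) (q0 : q != 0)
  (q_nroot : forall m : nat, (0 < m)%N -> ~~ m.-unity_root q)
  (n : nat) (b : R[i]) (b0 : b != 0) (x : R[i]) :
  (a ^- n * al_salam_chihara n (2^-1 * (a * x)) a (a * b) q : R[i]^o)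
    @[a --> cinfty_nbhs R] --> (al_salam_carlitz1 n b x q : R[i]^o).
Proof.
rewrite -rescaled_al_salam_chihara0 //.
have a0 : \forall a \near cinfty_nbhs R, a != 0.
  by exists 0 => a; rewrite normr_gt0.
(* The rescaling identity holds for [a != 0], hence eventually, which suffices for the limit. *)
apply: cvg_trans (_ : rescaled_al_salam_chihara n b x q (a ^- 2)
  @[a --> cinfty_nbhs R] --> (_ : R[i]^o)).
  apply: near_eq_cvg; near=> a.
  by rewrite al_salam_chihara_rescaledE //; near: a.
apply: (@cvg_rescaled_al_salam_chihara R[i]) => //.
(* It remains that [a ^- 2] tends to [0], as a product of two copies of [a^-1]. *)
under eq_fun do rewrite expr2 invfM.
rewrite -(mulr0 0).
by apply: (@cvgM R[i]); exact: cvg_inv_cinfty.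
Unshelve. all: by end_near.
Qed.
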